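(* Let $R$ be one of the chain rings $\mathbb{G}_4=\mathbb{Z}_4[X]/(X^2+X+1)$, $\mathbb{S}_4=\mathbb{F}_4[X]/(X^2)$, $\mathbb{T}_4=\mathbb{F}_4[X;a\mapsto a^2]/(X^2)$. Then $\mathrm{m}_5(R)\le 68$.
   Context: $\mathbb{F}_4[X;a\mapsto a^2]$ denotes the skew polynomial ring with commutation rule $Xa=a^2X$. For a finite chain ring $R$ of length $2$ with residue field $\mathbb{F}_q$, the projective Hjelmslev plane $\mathrm{PHG}(2,R)$ is the incidence structure whose points are the free rank-$1$ submodules of the right module $R_R^3$, whose lines are the free rank-$2$ submodules of $R_R^3$, with incidence given by inclusion. A projective $(k,n)$-arc is a set of $k$ points meeting every line in at most $n$ points. For $0\le n\le q^2+q$, $\mathrm{m}_n(R)$ denotes the largest $k$ such that a projective $(k,n)$-arc exists in $\mathrm{PHG}(2,R)$. *)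

(* Defs.v *)
From HB Require Import structures.
From mathcomp Require Import all_boot all_order all_algebra.
Set Implicit Arguments. Unset Strict Implicit. Unset Printing Implicit Defensive.
Import GRing.Theory.
Local Open Scope ring_scope.

(* F_4 = {0,1,w,w^2} encoded as 0,1,2,3 with w^2 = w + 1, i.e. the     *)
(* element with code 2*b1 + b0 is b1*w + b0 (3 = w + 1 = w^2).         *)
Definition mk4 (n : nat) : 'I_4 := Ordinal (ltn_pmod n (isT : (0 < 4)%N)).
Definition z4add (a b : 'I_4) : 'I_4 := mk4 (a + b).
Definition z4mul (a b : 'I_4) : 'I_4 := mk4 (a * b).
Definition z4opp (a : 'I_4) : 'I_4 := mk4 (4 - a).

Definition f4add (a b : 'I_4) : 'I_4 :=
  mk4 (((odd a) != (odd b)) + 2 * ((odd (a %/ 2)) != (odd (b %/ 2))))%N.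
(* discrete log in F_4^* : 1 = w^0, 2 = w^1, 3 = w^2 *)
Definition f4log (a : 'I_4) : nat := (a - 1)%N.
Definition f4exp (k : nat) : 'I_4 := mk4 ((k %% 3) + 1).
Definition f4mul (a b : 'I_4) : 'I_4 :=
  if (a == ord0) || (b == ord0) then ord0 else f4exp (f4log a + f4log b).
Definition f4sq (a : 'I_4) : 'I_4 := f4mul a a.

Definition l4 : seq 'I_4 := [:: mk4 0; mk4 1; mk4 2; mk4 3].
Lemma mem_l4 (x : 'I_4) : x \in l4.
Proof. by case: x => [[|[|[|[|n]]]] Hn]. Qed.
Definition l16 : seq ('I_4 * 'I_4) := [seq (a, b) | a <- l4, b <- l4].
Lemma mem_l16 (x : 'I_4 * 'I_4) : x \in l16.
Proof. by case: x => a b; apply/allpairsP; exists (a, b); rewrite !mem_l4. Qed.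

Lemma forall3 (P : 'I_4 * 'I_4 -> 'I_4 * 'I_4 -> 'I_4 * 'I_4 -> bool) :
  all (fun x => all (fun y => all (fun z => P x y z) l16) l16) l16 ->
  forall x y z, P x y z.
Proof.
move=> /allP H x y z; move/allP: (H x (mem_l16 x)) => /(_ y (mem_l16 y)).
by move/allP => /(_ z (mem_l16 z)).
Qed.

Lemma forall2 (P : 'I_4 * 'I_4 -> 'I_4 * 'I_4 -> bool) :
  all (fun x => all (fun y => P x y) l16) l16 -> forall x y, P x y.
Proof.
by move=> /allP H x y; move/allP: (H x (mem_l16 x)) => /(_ y (mem_l16 y)).
Qed.

Lemma forall1 (P : 'I_4 * 'I_4 -> bool) :
  all P l16 -> forall x, P x.
Proof. by move=> /allP H x; apply: H; apply: mem_l16. Qed.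

Ltac brute3 := let x := fresh "x" in let y := fresh "y" in let z := fresh "z" in
  intros x y z; apply/eqP; revert x y z;
  apply: forall3; vm_compute; reflexivity.
Ltac brute2 := let x := fresh "x" in let y := fresh "y" in
  intros x y; apply/eqP; revert x y;
  apply: forall2; vm_compute; reflexivity.
Ltac brute1 := let x := fresh "x" in
  intros x; apply/eqP; revert x;
  apply: forall1; vm_compute; reflexivity.

(* G_4 = Z_4[X]/(X^2+X+1): a + b w with w^2 = -1 - w.                  *)
Definition G4 : Type := ('I_4 * 'I_4)%type.
HB.instance Definition _ := Finite.on G4.

Definition g4zero : G4 := (ord0, ord0).
Definition g4one : G4 := (mk4 1, ord0).
Definition g4add (x y : G4) : G4 := (z4add x.1 y.1, z4add x.2 y.2).
Definition g4opp (x : G4) : G4 := (z4opp x.1, z4opp x.2).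
(* (a + b w)(c + d w) = (ac - bd) + (ad + bc - bd) w *)
Definition g4mul (x y : G4) : G4 :=
  (z4add (z4mul x.1 y.1) (z4opp (z4mul x.2 y.2)),
   z4add (z4add (z4mul x.1 y.2) (z4mul x.2 y.1)) (z4opp (z4mul x.2 y.2))).

Lemma g4addA : associative g4add. Proof. brute3. Qed.
Lemma g4addC : commutative g4add. Proof. brute2. Qed.
Lemma g4add0 : left_id g4zero g4add. Proof. brute1. Qed.
Lemma g4addN : left_inverse g4zero g4opp g4add. Proof. brute1. Qed.
Lemma g4mulA : associative g4mul. Proof. brute3. Qed.
Lemma g4mul1 : left_id g4one g4mul. Proof. brute1. Qed.
Lemma g4mulr1 : right_id g4one g4mul. Proof. brute1. Qed.
Lemma g4mulDl : left_distributive g4mul g4add. Proof. brute3. Qed.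
Lemma g4mulDr : right_distributive g4mul g4add. Proof. brute3. Qed.
Lemma g4one_neq0 : g4one != g4zero. Proof. by vm_compute. Qed.

HB.instance Definition _ := GRing.isNzRing.Build G4
  g4addA g4addC g4add0 g4addN g4mulA g4mul1 g4mulr1 g4mulDl g4mulDr g4one_neq0.

(* S_4 = F_4[X]/(X^2): a + b e with e^2 = 0 (commutative).             *)
Definition S4 : Type := ('I_4 * 'I_4)%type.
HB.instance Definition _ := Finite.on S4.

Definition s4zero : S4 := (ord0, ord0).
Definition s4one : S4 := (mk4 1, ord0).
Definition s4add (x y : S4) : S4 := (f4add x.1 y.1, f4add x.2 y.2).
Definition s4opp (x : S4) : S4 := x.
(* (a + b e)(c + d e) = ac + (ad + bc) e *)
Definition s4mul (x y : S4) : S4 :=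
  (f4mul x.1 y.1, f4add (f4mul x.1 y.2) (f4mul x.2 y.1)).

Lemma s4addA : associative s4add. Proof. brute3. Qed.
Lemma s4addC : commutative s4add. Proof. brute2. Qed.
Lemma s4add0 : left_id s4zero s4add. Proof. brute1. Qed.
Lemma s4addN : left_inverse s4zero s4opp s4add. Proof. brute1. Qed.
Lemma s4mulA : associative s4mul. Proof. brute3. Qed.
Lemma s4mul1 : left_id s4one s4mul. Proof. brute1. Qed.
Lemma s4mulr1 : right_id s4one s4mul. Proof. brute1. Qed.
Lemma s4mulDl : left_distributive s4mul s4add. Proof. brute3. Qed.
Lemma s4mulDr : right_distributive s4mul s4add. Proof. brute3. Qed.
Lemma s4one_neq0 : s4one != s4zero. Proof. by vm_compute. Qed.

HB.instance Definition _ := GRing.isNzRing.Build S4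
  s4addA s4addC s4add0 s4addN s4mulA s4mul1 s4mulr1 s4mulDl s4mulDr s4one_neq0.

(* T_4 = F_4[X; a |-> a^2]/(X^2): a + b X with X c = c^2 X, X^2 = 0.   *)
Definition T4 : Type := ('I_4 * 'I_4)%type.
HB.instance Definition _ := Finite.on T4.

Definition t4zero : T4 := (ord0, ord0).
Definition t4one : T4 := (mk4 1, ord0).
Definition t4add (x y : T4) : T4 := (f4add x.1 y.1, f4add x.2 y.2).
Definition t4opp (x : T4) : T4 := x.
(* (a + b X)(c + d X) = ac + (ad + b c^2) X *)
Definition t4mul (x y : T4) : T4 :=
  (f4mul x.1 y.1, f4add (f4mul x.1 y.2) (f4mul x.2 (f4sq y.1))).

Lemma t4addA : associative t4add. Proof. brute3. Qed.
Lemma t4addC : commutative t4add. Proof. brute2. Qed.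
Lemma t4add0 : left_id t4zero t4add. Proof. brute1. Qed.
Lemma t4addN : left_inverse t4zero t4opp t4add. Proof. brute1. Qed.
Lemma t4mulA : associative t4mul. Proof. brute3. Qed.
Lemma t4mul1 : left_id t4one t4mul. Proof. brute1. Qed.
Lemma t4mulr1 : right_id t4one t4mul. Proof. brute1. Qed.
Lemma t4mulDl : left_distributive t4mul t4add. Proof. brute3. Qed.
Lemma t4mulDr : right_distributive t4mul t4add. Proof. brute3. Qed.
Lemma t4one_neq0 : t4one != t4zero. Proof. by vm_compute. Qed.

HB.instance Definition _ := GRing.isNzRing.Build T4
  t4addA t4addC t4add0 t4addN t4mulA t4mul1 t4mulr1 t4mulDl t4mulDr t4one_neq0.

Section PHG.
Variable R : finNzRingType.

Definition vec := {ffun 'I_3 -> R}.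
Definition vzero : vec := [ffun => 0].
Definition vadd (x y : vec) : vec := [ffun i => x i + y i].
Definition vrscale (x : vec) (r : R) : vec := [ffun i => x i * r].

Definition is_point (S : {set vec}) : Prop :=
  exists x : vec,
    (forall r : R, vrscale x r = vzero -> r = 0) /\
    S = [set vrscale x r | r : R].

Definition is_line (S : {set vec}) : Prop :=
  exists x y : vec,
    (forall r s : R, vadd (vrscale x r) (vrscale y s) = vzero ->
       r = 0 /\ s = 0) /\
    S = [set vadd (vrscale x r) (vrscale y s) | r : R, s : R].

Definition proj_arc (n : nat) (P : {set {set vec}}) : Prop :=
  (forall p, p \in P -> is_point p) /\
  (forall L : {set vec}, is_line L ->
     #|[set p in P | p \subset L]| <= n)%N.

Definition m_le (n b : nat) : Prop :=
  forall k : nat, (exists P : {set {set vec}}, proj_arc n P /\ #|P| = k) ->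
    (k <= b)%N.

End PHG.

(* Main.v *)
Require Import Defs.
From mathcomp Require Import all_boot all_order all_algebra zify.
Set Implicit Arguments. Unset Strict Implicit. Unset Printing Implicit Defensive.

(* A set of 69 points of PHG(2,R) induces multiplicities u on the 21 neighbour
   classes, which form PG(2,4); put d = 4 - u and let D(l) be the sum of d over
   a line l of PG(2,4).  The 16 points of a class form AG(2,4), and the 16 lines
   in a neighbour class of lines, together with the 20 line segments they are
   made of, form a dual AG(2,4).  Adding up the four lines through a segment
   with w points in a class with u points gives D(l) >= 4w - u.

   Summing over the five directions shows u <= 4, and that a class with u = 4 is
   either a segment (giving a line with D >= 12) or an affine subplane AG(2,2)
   (giving three lines with D >= 4 that split it as 2+2+0+0), while a class with
   u = 3 gives a line with D >= 9 or three lines with D >= 5.  As the total of d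
   is 15, a line with D = 4 through a class with d = 0 would have all its d at
   most 1 (a finite search), which forces two lines with D >= 9 and too large a
   total.  Hence the lines through a class with d = 0 all have D = 0 or 5 unless
   one of them has D >= 12, and both alternatives contradict the identity: the
   sum of D(l) over the lines l through x is 15 + 4 d(x). *)

(** * Weights on a projective plane of order 4 *)

Section Plane.
Variables (P L : finType) (I : P -> L -> bool).
Hypothesis joinP : forall x y,
  #|[pred l | I x l && I y l]| = if x == y then 5 else 1.
Hypothesis meetL : forall l m,
  #|[pred x | I x l && I x m]| = if l == m then 5 else 1.
Variable d : P -> nat.

Definition lweight l := \sum_(x | I x l) d x.
Local Notation D := lweight.

(** Every point other than [x] is on exactly one line through [x], while [x] is on five. *)
Lemma pencil_weight x : \sum_(l | I x l) D l = \sum_y d y + 4 * d x.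
Proof.
rewrite /D (exchange_big_dep predT) //=.
rewrite (eq_bigr (fun y => d y + (if y == x then 4 * d x else 0))).
  by rewrite big_split /= -big_mkcond /= big_pred1_eq.
move=> y _; rewrite sum_nat_const joinP eq_sym.
by case: eqP => [->|_]; lia.
Qed.

Lemma pencil_const x k : \sum_(l | I x l) k = 5 * k.
Proof.
have := joinP x x; rewrite eqxx sum_nat_const => <-; congr (_ * _).
by apply: eq_card => l; rewrite !inE andbb.
Qed.

Lemma range_card l : \sum_(x | I x l) 1 = 5.
Proof.
have := meetL l l; rewrite eqxx -sum1_card => <-.
by apply: eq_bigl => x; rewrite inE andbb.
Qed.

Lemma meet_unique l m x y :
  l != m -> I x l -> I x m -> I y l -> I y m -> x = y.
Proof.
move=> nlm xl xm yl ym; have := meetL l m; rewrite (negPf nlm) => /eq_leq.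
by move/card_le1_eqP; apply; rewrite inE ?xl ?yl.
Qed.

Lemma meet_exists l m : exists2 x, I x l & I x m.
Proof.
have : 0 < #|[pred x | I x l && I x m]| by rewrite meetL; case: ifP.
by case/card_gt0P => x; rewrite inE => /andP[xl xm]; exists x.
Qed.

Lemma lweight_cond l : D l = \sum_x I x l * d x.
Proof.
by rewrite /D big_mkcond; apply: eq_bigr => x _; case: (I x l); rewrite ?mul1n.
Qed.

Lemma lweight_ge x l : I x l -> d x <= D l.
Proof. by move=> xl; rewrite /D (bigD1 x) //= leq_addr. Qed.

Lemma sum_delta (T : finType) (x : T) (F : T -> nat) :
  \sum_y (y == x) * F y = F x.
Proof.
rewrite (bigD1 x) //= eqxx mul1n big1 ?addn0 // => y /negPf-> //.
Qed.

(** A point on several of the lines is among [x], [y], [z], so it lies on at most 1 plus as many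
    lines as it has occurrences there; this covers concurrent lines too. *)
Lemma three_lines_weight a b c x y z :
    a != b -> a != c -> b != c ->
    I x a -> I x b -> I y a -> I y c -> I z b -> I z c ->
  D a + D b + D c <= \sum_t d t + d x + d y + d z.
Proof.
move=> ab ac bc xa xb ya yc zb zc; rewrite !lweight_cond.
rewrite -(sum_delta x d) -(sum_delta y d) -(sum_delta z d) -!big_split /=.
apply: leq_sum => t _.
have : I t a && I t b ==> (t == x).
  by apply/implyP=> /andP[ta tb]; apply/eqP; apply: (meet_unique ab).
have : I t a && I t c ==> (t == y).
  by apply/implyP=> /andP[ta tb]; apply/eqP; apply: (meet_unique ac).
have : I t b && I t c ==> (t == z).
  by apply/implyP=> /andP[ta tb]; apply/eqP; apply: (meet_unique bc).
move=> h1 h2 h3.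
apply: (@leq_trans ((1 + (t == x) + (t == y) + (t == z)) * d t)); last first.
  by rewrite !mulnDl mul1n.
rewrite -!mulnDl leq_mul2r; apply/orP; right.
by move: h1 h2 h3; case: (I t a) (I t b) (I t c) (t == x) (t == y) (t == z)
  => [] [] [] [] [] [].
Qed.

Lemma two_lines_weight a b x : a != b -> I x a -> I x b ->
  D a + D b <= \sum_t d t + d x.
Proof.
move=> ab xa xb; rewrite !lweight_cond -(sum_delta x d) -!big_split /=.
apply: leq_sum => t _.
have : I t a && I t b ==> (t == x).
  by apply/implyP=> /andP[ta tb]; apply/eqP; apply: (meet_unique ab).
move=> h1; apply: (@leq_trans ((1 + (t == x)) * d t)); last by rewrite mulnDl mul1n.
rewrite -!mulnDl leq_mul2r; apply/orP; right.
by move: h1; case: (I t a) (I t b) (t == x) => [] [] [].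
Qed.

Hypothesis cardP : #|P| = 21.
Hypothesis d_le4 : forall x, d x <= 4.
Hypothesis sum_d : \sum_x d x = 15.
(* [even x l] will say that the lines of class [l] split the four arc points of
   the class [x] as 2+2+0+0. *)
Variable even : P -> L -> bool.
Hypothesis d0 : forall x, d x = 0 ->
  (exists2 l, I x l & 12 <= D l) \/
  3 <= #|[pred l | I x l && even x l]| /\
  (forall l, I x l -> even x l -> 4 <= D l).
Hypothesis d1 : forall x, d x = 1 ->
  (exists2 l, I x l & 9 <= D l) \/ 3 <= #|[pred l | I x l && (5 <= D l)]|.
Hypothesis D4 : forall l x, D l = 4 -> I x l -> d x = 0 ->
  (forall y, I y l -> d y = 0 -> even y l) -> forall y, I y l -> d y <= 1.

Lemma sum_pencil_cond x (A : pred L) k :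
  \sum_(l | I x l) k * A l = k * #|[pred l | I x l && A l]|.
Proof.
rewrite -big_distrr /= -sum1_card big_mkcondr /=.
by congr (_ * _); apply: eq_bigr => l _; case: (A l).
Qed.

Lemma sum_pencil_delta x l (k : nat) : I x l -> \sum_(m | I x m) k * (m == l) = k.
Proof.
move=> xl; rewrite (bigD1 l) //= eqxx muln1 big1 ?addn0 // => m.
by case/andP=> _ /negPf->; rewrite muln0.
Qed.

(** All zero points of [l] are even along [l], so [D4] leaves d <= 1 on [l]. Two points of weight 1
    then carry lines of weight at least 9, and 4 + 9 + 9 = 22 exceeds 15 + 1 + 1 + 4. *)
Lemma no_D4_zero l x : D l = 4 -> I x l -> d x = 0 -> False.
Proof.
move=> Dl xl dx.
have ev y : I y l -> d y = 0 -> even y l.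
  move=> yl dy; have [[n yn Dn]|[c3 ge4]] := d0 dy.
    case: (eqVneq l n) Dn => [<-|ln Dn]; first by rewrite Dl.
    by have := two_lines_weight ln yl yn; lia.
  apply: contraT => nev; have := pencil_weight y.
  (* Three even lines of weight at least 4, together with [l], would exceed the pencil total 15. *)
  suff : \sum_(m | I y m) (4 * even y m + 4 * (m == l)) <=
         \sum_(m | I y m) D m.
    by rewrite big_split /= sum_pencil_cond sum_pencil_delta //; lia.
  apply: leq_sum => m ym; case: eqP => [->|_]; first by rewrite Dl (negPf nev).
  by case: (boolP (even y m)) => // /(ge4 _ ym); lia.
have dle1 := D4 Dl xl dx ev.
have D9 y : I y l -> d y = 1 -> exists2 n, I y n & 9 <= D n.
  move=> yl dy; have [//|c3] := d1 dy; exfalso.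
  have := pencil_weight y.
  (* Each line through [y] weighs at least 1, three weigh at least 5, and [l] weighs 4: at least 20
     in all, but the pencil total is 15 + 4. *)
  suff : \sum_(m | I y m) (1 + 4 * (5 <= D m) + 3 * (m == l)) <=
         \sum_(m | I y m) D m.
    have /= E := sum_pencil_cond y (fun m => 5 <= D m) 4.
    rewrite big_split /= big_split /= E sum_pencil_delta //.
    by rewrite pencil_const; lia.
  apply: leq_sum => m ym; have := lweight_ge ym.
  by case: eqP => [->|_]; rewrite ?Dl; lia.
have : 1 < #|[pred y | I y l && (d y == 1)]|.
  move: Dl; rewrite /D -sum1_card big_mkcondr /= => Dl.
  suff : \sum_(y | I y l) d y = \sum_(y | I y l) (if d y == 1 then 1 else 0).
    by lia.
  by apply: eq_bigr => y /dle1; case: eqP; lia.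
case/card_gt1P => y [y' [+ + nyy']].
rewrite !inE => /andP[yl /eqP dy] /andP[yl' /eqP dy'].
have [n yn Dn] := D9 _ yl dy; have [n' yn' Dn'] := D9 _ yl' dy'.
have ln : l != n by apply/eqP=> E; move: Dn; rewrite -E Dl.
have ln' : l != n' by apply/eqP=> E; move: Dn'; rewrite -E Dl.
have nn' : n != n'.
  apply/eqP=> E; move/eqP: nyy'; apply; apply: (meet_unique ln) => //.
  by rewrite E.
have [z zn zn'] := meet_exists n n'.
have := three_lines_weight ln ln' nn' yl yn yl' yn' zn zn'.
by have := d_le4 z; rewrite Dl dy dy' sum_d; clear -Dn Dn'; lia.
Qed.

(** Three even lines of weight at least 5 exhaust the pencil total 15, so they weigh exactly 5 and
    the others 0. *)
Lemma zero_pencil x : d x = 0 ->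
  (exists2 l, I x l & 12 <= D l) \/ forall l, I x l -> D l = 0 \/ D l = 5.
Proof.
move=> dx; have [?|[c3 ge4]] := d0 dx; [by left|right=> l xl].
have ge5 m : I x m -> even x m -> 5 <= D m.
  move=> xm em; have := ge4 _ xm em; rewrite leq_eqVlt => /orP[/eqP E|//].
  by case: (no_D4_zero (esym E) xm dx).
have := pencil_weight x.
have : \sum_(m | I x m) (5 * even x m + (D l - 5 * even x l) * (m == l)) <=
       \sum_(m | I x m) D m.
  apply: leq_sum => m xm; case: eqP => [->|_].
    by case: (boolP (even x l)) => [/(ge5 _ xl)|_]; lia.
  by case: (boolP (even x m)) => [/(ge5 _ xm)|_]; lia.
rewrite big_split /= sum_pencil_cond sum_pencil_delta //.
by case: (boolP (even x l)) => [/(ge5 _ xl)|_]; lia.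
Qed.

(** Through a point [x] of [l] with d(x) > 0, every other line weighs 5. Hence D(l) + 20 = 15 + 4
    d(x) <= 31, against D(l) >= 12. *)
Lemma no_heavy_line l : 12 <= D l -> False.
Proof.
move=> Dl; have [x xl dx] : exists2 x, I x l & 0 < d x.
  apply/exists_inP; apply: contraLR Dl => /exists_inPn H.
  by rewrite /D big1 // => x /H; lia.
have D5 m : I x m -> m != l -> D m = 5.
  (* Without a zero point besides [x], the line [m] would weigh at least 4 + d(x), and with [l] at
     least 16 + d(x) > 15 + d(x). *)
  move=> xm ml; have [y /andP[ym nyx] /eqP dy] :
      exists2 y, I y m && (y != x) & d y == 0.
    apply/exists_inP; apply: contraT => /exists_inPn H.
    have := two_lines_weight ml xm xl; rewrite sum_d {1}/D (bigD1 x) //=.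
    have : \sum_(y | I y m && (y != x)) 1 <= \sum_(y | I y m && (y != x)) d y.
      by apply: leq_sum => y /H; lia.
    have := range_card m; rewrite (bigD1 x) //= => E.
    by lia.
  have nyl : ~~ I y l.
    by apply: contra nyx => yl; apply/eqP; apply: (meet_unique ml).
  have [[n yn Dn]|/(_ _ ym) [Dm|//]] := zero_pencil dy.
    have ln : l != n by apply: contraNneq nyl => ->.
    have [z zl zn] := meet_exists l n.
    by have := two_lines_weight ln zl zn; have := d_le4 z; clear -Dl Dn sum_d; lia.
  by have := lweight_ge xm; lia.
have := pencil_weight x; rewrite (bigD1 l) //=.
rewrite (eq_bigr (fun=> 5)); last by move=> m /andP[]; apply: D5.
have := pencil_const x 5; rewrite (bigD1 l) //= sum_d => E.
by have := d_le4 x; lia.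
Qed.

(** As 21 > 15, some point has weight 0, and its pencil total 15 leaves a line of weight 0. All
    lines meet that line, so all weigh 0 or 5; a point [y] of positive weight then gives 25 = 15 + 4
    d(y), which is impossible. *)
Lemma no_deficiency : False.
Proof.
have zp x : d x = 0 -> forall l, I x l -> D l = 0 \/ D l = 5.
  by move=> dx; have [[l _ /no_heavy_line]|] := zero_pencil dx.
have [x /eqP dx] : exists x, d x == 0.
  apply/existsP; apply: contraT => /existsPn H.
  have : \sum_(x : P) 1 <= \sum_x d x by apply: leq_sum => x _; have := H x; lia.
  by rewrite sum1_card cardP sum_d.
have [m xm /eqP Dm] : exists2 m, I x m & D m == 0.
  apply/exists_inP; apply: contraT => /exists_inPn H.
  have := pencil_weight x; rewrite (eq_bigr (fun=> 5)).
    by rewrite pencil_const; lia.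
  by move=> l xl; have [] := zp _ dx _ xl => // E; have := H _ xl; rewrite E.
have all05 l : D l = 0 \/ D l = 5.
  have [z zm zl] := meet_exists m l; apply: (zp z) => //.
  by have := lweight_ge zm; lia.
have [y dy] : exists y, 0 < d y.
  apply/existsP; apply: contraT => /existsPn H.
  by move: sum_d; rewrite big1 // => y _; have := H y; lia.
have := pencil_weight y; rewrite (eq_bigr (fun=> 5)).
  by rewrite pencil_const sum_d; lia.
by move=> l /lweight_ge; have := all05 l; lia.
Qed.

End Plane.

(** * Listings of finite types *)

Section Listing.
Variables (T : finType) (s : seq T).
Hypotheses (s_uniq : uniq s) (s_full : forall x, x \in s).

(** Lets sums and cardinals over finite types be evaluated by [vm_compute] on explicit lists. *)
Lemma perm_listing : perm_eq (index_enum T) s.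
Proof.
by apply: uniq_perm; rewrite ?index_enum_uniq // => x; rewrite mem_index_enum s_full.
Qed.

Lemma sum_listing (p : pred T) (F : T -> nat) :
  \sum_(x | p x) F x = \sum_(x <- s | p x) F x.
Proof. exact/perm_big/perm_listing. Qed.

Lemma card_listing (p : pred T) : #|p| = count p s.
Proof. by rewrite -sum1_card sum_listing sum1_count. Qed.

Lemma forall_listing (p : pred T) : all p s -> forall x, p x.
Proof. by move=> /allP H x; apply: H. Qed.
End Listing.

Notation pos := ('I_4 * 'I_4)%type.
Notation dir := (option 'I_4).

Lemma l4_uniq : uniq l4. Proof. by []. Qed.
Lemma l16_uniq : uniq l16. Proof. by []. Qed.

Definition dirs : seq dir := None :: map some l4.
Lemma dirs_uniq : uniq dirs. Proof. by []. Qed.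
Lemma mem_dirs t : t \in dirs.
Proof. by case: t => [x|] //; rewrite in_cons [_ \in map _ _]map_f ?mem_l4. Qed.

(* [seg s a] numbers the line of slope [s] of AG(2,4) through [a]; [None] is the
   vertical direction. *)
Definition seg (s : dir) (a : pos) : 'I_4 :=
  if s is Some m then f4add a.2 (f4mul m a.1) else a.1.

Definition count_l16 := card_listing l16_uniq mem_l16.
Definition count_dirs := card_listing dirs_uniq mem_dirs.

Lemma seg_meet s t v w :
  #|[pred b | (seg s b == v) && (seg t b == w)]| =
  if s == t then 4 * (v == w) else 1.
Proof.
rewrite count_l16; apply/eqP; move: w; apply: (forall_listing mem_l4).
move: v; apply: (forall_listing mem_l4); move: t; apply: (forall_listing mem_dirs).
move: s; apply: (forall_listing mem_dirs).
by vm_compute.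
Qed.

(** * A neighbour class of lines *)

(* [W t v] is the number of arc points on the [v]-th segment cut out in the
   [t]-th of the five point classes; the 16 lines are indexed by [b]. *)
Section LineClass.
Variable W : dir -> 'I_4 -> nat.
Hypothesis W5 : forall b, \sum_t W t (seg t b) <= 5.
Definition rsum t := \sum_v W t v.

Lemma segment_bound t v : 4 * W t v + \sum_s rsum s <= 20 + rsum t.
Proof.
have c4 : #|[pred b | seg t b == v]| = 4.
  have := seg_meet t t v v; rewrite !eqxx muln1; apply: etrans.
  by apply: eq_card => b; rewrite !inE andbb.
have : \sum_(b | seg t b == v) \sum_s W s (seg s b) <= 20.
  apply: leq_trans (_ : \sum_(b | seg t b == v) 5 <= _); first exact: leq_sum.
  by rewrite sum_nat_const (c4 : #|fun b => seg t b == v| = 4).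
rewrite exchange_big /= (bigD1 t) //= [\sum_s rsum s](bigD1 t) //=.
rewrite (eq_bigr (fun=> W t v)); last by move=> b /eqP->.
rewrite sum_nat_const (c4 : #|fun b => seg t b == v| = 4).
suff -> : \sum_(s | s != t) \sum_(b | seg t b == v) W s (seg s b) =
          \sum_(s | s != t) rsum s by move=> ?; rewrite addnCA addnC leq_add2r.
(* Each segment of another class is on exactly one of the four lines through segment [v], so that
   class is counted once in full. *)
apply: eq_bigr => s nst; rewrite /rsum (partition_big (seg s) predT) //=.
apply: eq_bigr => w _; rewrite (eq_bigr (fun=> W s w)); last first.
  by move=> b /andP[_ /eqP->].
rewrite sum_nat_const -[RHS]mul1n; congr (_ * _).
by have := seg_meet t s v w; rewrite eq_sym (negPf nst).
Qed.

End LineClass.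

(** * Exhaustive search within a line class with 16 arc points *)

Fixpoint words (A : seq nat) n : seq (seq nat) :=
  if n is n'.+1 then [seq x :: w | x <- A, w <- words A n'] else [:: [::]].

Lemma mem_words A w : (w \in words A (size w)) = all (mem A) w.
Proof.
elim: w => //= x w IH; rewrite -IH.
apply/allpairsP/andP => [[[y z] /= [yA zw [ex ew]]]|[xA ww]].
  by subst x w.
by exists (x, w).
Qed.

(** Possible distributions of [u] points over four parallel segments: 0 or 2 each in an even full
    class; for u <= 3 the bound 4w + 16 <= 20 + u forces w <= 1. *)
Definition rows u :=
  [seq r <- words (if u == 4 then [:: 0; 2] else [:: 0; 1]) 4 | sumn r == u].

Definition segs t := [seq nat_of_ord (seg t b) | b <- l16].
Definition add_row (acc ss r : seq nat) := [seq p.1 + nth 0 r p.2 | p <- zip acc ss].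

(* [if] rather than [==>]: the virtual machine evaluates both sides of a
   boolean operator, which would defeat the pruning. *)
Fixpoint unsat (todo : seq (dir * nat)) (acc : seq nat) : bool :=
  if todo is (t, u) :: todo' then
    let ss := segs t in
    all (fun r => let acc' := add_row acc ss r in
           if all (leq^~ 5) acc' then unsat todo' acc' else true) (rows u)
  else false.

Definition bad_profile (us : seq nat) :=
  [&& sumn us == 16, 4 \in us & has (leq^~ 2) us].

(** Larger classes come first so that overflowing lines prune the search early. *)
Definition profile_order (us : seq nat) :=
  sort (fun p q : dir * nat => q.2 <= p.2) (zip dirs us).

Lemma bad_profiles_unsat :
  all (fun us => if bad_profile us then unsat (profile_order us) (nseq 16 0) else true)
    (words (iota 0 5) 5).
Proof. by vm_compute. Qed.

Lemma nth_l4 (F : 'I_4 -> nat) (v : 'I_4) : nth 0 [seq F w | w <- l4] v = F v.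
Proof.
rewrite (nth_map ord0); last by case: v.
by congr F; apply/eqP; move: v; apply: (forall_listing mem_l4).
Qed.

(** The partial sums [acc] are arbitrary for the sake of the induction; since every choice of rows
    overflows some line, the rows of [W] do. *)
Lemma unsat_sound (W : dir -> 'I_4 -> nat) todo acc :
    size acc = 16 -> unsat todo acc ->
    (forall p, p \in todo -> [seq W p.1 v | v <- l4] \in rows p.2) ->
  exists2 j, j < 16 &
    5 < nth 0 acc j + \sum_(p <- todo) W p.1 (seg p.1 (nth (ord0, ord0) l16 j)).
Proof.
elim: todo acc => [//|[t u] todo IH] acc sz_acc /allP uns rowsP.
have /uns := rowsP _ (mem_head _ _).
set acc' := add_row _ _ _ => uns'; cbv zeta beta in uns'.
have sz : size acc' = 16 by rewrite size_map size_zip sz_acc size_map.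
have nth_acc' j : j < 16 ->
    nth 0 acc' j = nth 0 acc j + W t (seg t (nth (ord0, ord0) l16 j)).
  move=> lt_j; rewrite (nth_map (0, 0)) ?size_zip ?sz_acc ?size_map //.
  by rewrite nth_zip ?sz_acc ?size_map //= (nth_map (ord0, ord0)) // nth_l4.
case: (boolP (all (leq^~ 5) acc')) uns' => [le5 uns'|nle5 _].
  have [|j lt_j gt5] := IH acc' sz uns'.
    by move=> p pt; apply: rowsP; rewrite in_cons pt orbT.
  by exists j => //; rewrite big_cons addnA -nth_acc'.
(* A line that already overflows keeps doing so, as the remaining classes only add points. *)
move/allPn: nle5 => [x /(nthP 0) [j lt_j <-]]; rewrite -ltnNge => gt5.
rewrite sz in lt_j; exists j => //; rewrite big_cons addnA -nth_acc' //.
exact: leq_trans gt5 (leq_addr _ _).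
Qed.

Section LineClass16.
Variable W : dir -> 'I_4 -> nat.
Hypothesis W5 : forall b, \sum_t W t (seg t b) <= 5.
Hypothesis rsum_le4 : forall t, rsum W t <= 4.
Hypothesis sum_rsum : \sum_t rsum W t = 16.
Hypothesis rsum4 : forall t, rsum W t = 4 -> forall v, (W t v == 0) || (W t v == 2).

Lemma row_in t : [seq W t v | v <- l4] \in rows (rsum W t).
Proof.
rewrite mem_filter; apply/andP; split.
  by rewrite sumnE big_map -(sum_listing l4_uniq mem_l4).
rewrite -[4]/(size [seq W t v | v <- l4]) mem_words all_map; apply/allP => v _ /=.
case: eqP => [/rsum4/(_ v)|u4]; first by rewrite !inE.
have := segment_bound W5 t v; have := rsum_le4 t; rewrite sum_rsum !inE.
by case: (W t v) => [|[|w]] //=; lia.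
Qed.

Lemma full_row_profile t0 : rsum W t0 = 4 -> forall t, 3 <= rsum W t.
Proof.
move=> u0 t; rewrite leqNgt; apply/negP => lt3.
set us := [seq rsum W t | t <- dirs].
have us_words : us \in words (iota 0 5) 5.
  rewrite -[X in words _ X]/(size us) mem_words all_map; apply/allP => s _.
  by change (rsum W s \in iota 0 5); rewrite mem_iota ltnS rsum_le4.
have us_bad : bad_profile us.
  apply/and3P; split.
  - by rewrite sumnE big_map -(sum_listing dirs_uniq mem_dirs) sum_rsum.
  - by rewrite -u0 map_f ?mem_dirs.
  - by rewrite has_map; apply/hasP; exists t; rewrite ?mem_dirs.
have /allP/(_ _ us_words) := bad_profiles_unsat; rewrite us_bad => uns.
have todoE : zip dirs us = [seq (s, rsum W s) | s <- dirs] by [].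
have [|p|j lt_j] := @unsat_sound W _ _ _ uns; first by [].
  rewrite mem_sort todoE => /mapP[s _ ->] /=; exact: row_in.
rewrite nth_nseq lt_j (perm_big _ (permEl (perm_sort _ _))) todoE big_map /=.
by rewrite -(sum_listing dirs_uniq mem_dirs) ltnNge add0n W5.
Qed.
End LineClass16.

(** * A neighbour class of points *)

Definition sect (A : pred pos) s v := #|[pred a | A a && (seg s a == v)]|.

Lemma sum_sect A s : \sum_v sect A s v = #|A|.
Proof.
rewrite -sum1_card (partition_big (seg s) predT) //=.
by apply: eq_bigr => v _; rewrite /sect -sum1_card; apply: eq_bigl => a; rewrite !inE.
Qed.

Lemma sect_avg A s : exists v, #|A| <= 4 * sect A s v.
Proof.
apply/existsP; apply: contraT => /existsPn H; have := sum_sect A s.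
rewrite (sum_listing l4_uniq mem_l4) /l4 !big_cons big_nil.
move: (H (mk4 0)) (H (mk4 1)) (H (mk4 2)) (H (mk4 3)).
move: (sect A s (mk4 0)) (sect A s (mk4 1)) (sect A s (mk4 2)) (sect A s (mk4 3)).
by move: #|A|; clear; lia.
Qed.

(** If u >= 5, each direction has a segment with at least 2 points, so 40 <= 31 + u and u >= 9; then
    at least 3 points each, so 60 <= 31 + u, against u <= 16. *)
Lemma class_le4 A :
    (forall g, 4 * \sum_s sect A s (g s) <= 31 + #|A|) -> #|A| <= 4.
Proof.
move=> H; have /fin_all_exists [g Hg] := sect_avg A.
have : #|A| <= 16 by apply: leq_trans (max_card _) _; rewrite card_prod !card_ord.
have := H g; rewrite (sum_listing dirs_uniq mem_dirs) /dirs /= !big_cons big_nil.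
move: (Hg None) (Hg (Some (mk4 0))) (Hg (Some (mk4 1))).
move: (Hg (Some (mk4 2))) (Hg (Some (mk4 3))).
move: (sect A None _) (sect A (Some (mk4 0)) _) (sect A (Some (mk4 1)) _).
move: (sect A (Some (mk4 2)) _) (sect A (Some (mk4 3)) _) #|A|.
by clear; lia.
Qed.

(** * Classification of the classes with three or four arc points *)

Fixpoint subseqs (T : Type) k (s : seq T) : seq (seq T) :=
  match k, s with
  | 0, _ => [:: [::]]
  | _, [::] => [::]
  | k'.+1, x :: s' => [seq x :: t | t <- subseqs k' s'] ++ subseqs k s'
  end.

Lemma mem_subseqs (T : eqType) (s t : seq T) :
  subseq t s -> t \in subseqs (size t) s.
Proof.
elim: s t => [|x s IH] [|y t] //= sub; rewrite mem_cat.
case: eqP sub => [<-|_] sub; last by rewrite (IH (y :: t)) ?orbT.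
by apply/orP; left; apply: map_f; apply: IH.
Qed.

Definition sections (A : seq pos) : seq (seq nat) :=
  [seq (let w := map (seg s) A in [seq count_mem v w | v <- l4]) | s <- dirs].

(** The bound is tested on the fullest segment in each direction, hence the maxima. *)
Definition class_check n (A : seq pos) :=
  let M := sections A in
  if 4 * sumn [seq foldr maxn 0 r | r <- M] <= 31 + n then
    if n == 4 then
      has (has (eq_op^~ 4)) M ||
      (3 <= count (all (fun k => (k == 0) || (k == 2))) M)
    else has (has (leq 3)) M || (3 <= count (has (leq 2)) M)
  else true.

(** The five maxima add up to at most 8. A quadrangle yields 5 plus its number of secant directions,
    so its six secants fall into three parallel pairs; exactly three collinear points would yield 3
    + 2 + 2 + 2 + 1 = 10. *)
Lemma class_check4 : all (class_check 4) (subseqs 4 l16). Proof. by vm_compute. Qed.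
(** Three points are collinear or form a triangle whose sides have distinct directions. *)
Lemma class_check3 : all (class_check 3) (subseqs 3 l16). Proof. by vm_compute. Qed.

Definition even_dir (A : pred pos) s :=
  [forall v, (sect A s v == 0) || (sect A s v == 2)].

Lemma sectionsE (A : pred pos) :
  sections [seq a <- l16 | A a] = [seq [seq sect A s v | v <- l4] | s <- dirs].
Proof.
apply: eq_map => s; apply: eq_map => v.
rewrite count_map count_filter /sect count_l16; apply: eq_count => a.
by rewrite /= andbC.
Qed.

Lemma foldr_maxn_l4 (F : 'I_4 -> nat) :
  exists v, foldr maxn 0 [seq F v | v <- l4] = F v.
Proof. by rewrite /= maxn0 /maxn; do ![case: ifP => _]; eexists. Qed.

Section ClassTypes.
Variable A : pred pos.
Hypothesis HA : forall g, 4 * \sum_s sect A s (g s) <= 31 + #|A|.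

Let A_sub : [seq a <- l16 | A a] \in subseqs #|A| l16.
Proof.
have <- : size [seq a <- l16 | A a] = #|A| by rewrite size_filter count_l16.
by rewrite mem_subseqs ?filter_subseq.
Qed.

Let check_hyp n : #|A| = n ->
  4 * sumn [seq foldr maxn 0 r | r <- sections [seq a <- l16 | A a]] <= 31 + n.
Proof.
move=> <-; have /fin_all_exists [g Hg] s := foldr_maxn_l4 (sect A s).
rewrite sectionsE sumnE !big_map -(sum_listing dirs_uniq mem_dirs).
apply: leq_trans (HA g); rewrite leq_pmul2l //.
by apply: leq_sum => s _; rewrite Hg.
Qed.

Lemma class4 : #|A| = 4 ->
  (exists s v, sect A s v = 4) \/ 3 <= #|[pred s | even_dir A s]|.
Proof.
move=> A4; move: A_sub; rewrite A4 => /(allP class_check4).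
rewrite /class_check; cbv zeta; rewrite (check_hyp A4) sectionsE eqxx.
case/orP=> H; [left|right].
  case/hasP: H => r /mapP[s _ ->] /hasP[k /mapP[v _ ->] /eqP E].
  by exists s, v.
rewrite count_dirs; apply: leq_trans H _; rewrite count_map.
apply: sub_count => s /allP H; apply/forallP=> v; apply: H.
by rewrite map_f ?mem_l4.
Qed.

Lemma class3 : #|A| = 3 ->
  (exists s v, 3 <= sect A s v) \/
  3 <= #|[pred s | [exists v, 2 <= sect A s v]]|.
Proof.
move=> A3; move: A_sub; rewrite A3 => /(allP class_check3).
rewrite /class_check; cbv zeta; rewrite (check_hyp A3) sectionsE -[3 == 4]/false.
case/orP=> H; [left|right].
  case/hasP: H => r /mapP[s _ ->] /hasP[k /mapP[v _ ->] E].
  by exists s, v.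
rewrite count_dirs; apply: leq_trans H _; rewrite count_map.
apply: sub_count => s /hasP[k /mapP[v _ ->] E].
by apply/existsP; exists v.
Qed.
End ClassTypes.

(** * The plane of neighbour classes *)

(* A point class [inl (x, y)], [inr (inl y)], [inr (inr tt)] has residue vector
   (1,x,y), (0,1,y), (0,0,1).  A line class [inl (p, q)], [inr (inl p)],
   [inr (inr tt)] has residue equation z2 = p z0 + q z1, z1 = p z0, z0 = 0. *)
Notation cls := (pos + ('I_4 + unit))%type.

Definition inc (c l : cls) : bool :=
  match c, l with
  | inl (x, y), inl (p, q) => y == f4add p (f4mul q x)
  | inr (inl y), inl (p, q) => y == q
  | inl (x, y), inr (inl p) => x == p
  | inr (inr _), inr (inl _) | inr _, inr (inr _) => true
  | _, _ => false
  end.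

(* The direction in which the lines of class [l] cut the point class [c]. *)
Definition pdir (c l : cls) : dir :=
  match c, l with
  | inl _, inl (p, q) => Some q
  | inr (inl _), inl (p, q) => Some p
  | inr (inr _), inr (inl p) => Some p
  | _, _ => None
  end.

Definition join_dir (c : cls) (s : dir) : cls :=
  match c, s with
  | inl (x, y), Some q => inl (f4add y (f4mul q x), q)
  | inl (x, y), None => inr (inl x)
  | inr (inl y), Some p => inl (p, y)
  | inr (inr _), Some p => inr (inl p)
  | inr _, None => inr (inr tt)
  end.

Definition twist (tw : bool) (x : 'I_4) : 'I_4 := if tw then f4sq x else x.

(* The dual of [pdir]; over T_4 the coefficients of the line pick up a Frobenius
   twist when they are moved past the residue of the point. *)
Definition ldir (tw : bool) (c l : cls) : dir :=
  match c, l with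
  | inl (x, y), inl _ => Some (twist tw x)
  | inl (x, y), inr _ => Some (twist tw y)
  | inr (inl y), inr (inr _) => Some (twist tw y)
  | _, _ => None
  end.

(** Inverse of [ldir] along [l]; the same [twist] serves both ways, being an involution. *)
Definition meet_dir (tw : bool) (l : cls) (t : dir) : cls :=
  match l, omap (twist tw) t with
  | inl (p, q), Some x => inl (x, f4add p (f4mul q x))
  | inl (p, q), None => inr (inl q)
  | inr (inl p), Some y => inl (p, y)
  | inr (inr _), Some y => inr (inl y)
  | inr _, None => inr (inr tt)
  end.

Definition classes : seq cls :=
  map inl l16 ++ map inr (rcons (map inl l4) (inr tt)).

Lemma classes_uniq : uniq classes. Proof. by vm_compute. Qed.
Lemma mem_classes c : c \in classes.
Proof.
rewrite mem_cat; case: c => [a|[y|[]]]; first by rewrite map_f ?mem_l16.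
  rewrite [X in _ || X]map_f ?orbT // mem_rcons in_cons.
  by rewrite [X in _ || X]map_f ?orbT // mem_l4.
by rewrite [X in _ || X]map_f ?orbT // mem_rcons mem_head.
Qed.
Definition count_classes := card_listing classes_uniq mem_classes.

Lemma card_cls : #|{: cls}| = 21.
Proof. by rewrite !card_sum card_prod card_unit !card_ord. Qed.

Lemma inc_join x y : #|[pred l | inc x l && inc y l]| = if x == y then 5 else 1.
Proof.
rewrite count_classes; apply/eqP; move: y; apply: (forall_listing mem_classes).
by move: x; apply: (forall_listing mem_classes); vm_compute.
Qed.

Lemma inc_meet l m : #|[pred x | inc x l && inc x m]| = if l == m then 5 else 1.
Proof.
rewrite count_classes; apply/eqP; move: m; apply: (forall_listing mem_classes).
by move: l; apply: (forall_listing mem_classes); vm_compute.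
Qed.

Lemma inc_join_dir c s : inc c (join_dir c s) && (pdir c (join_dir c s) == s).
Proof.
move: s; apply: (forall_listing mem_dirs).
by move: c; apply: (forall_listing mem_classes); vm_compute.
Qed.

Lemma pdirK c l : inc c l -> join_dir c (pdir c l) = l.
Proof.
move=> cl; apply/eqP; move: cl; apply/implyP.
move: l; apply: (forall_listing mem_classes).
by move: c; apply: (forall_listing mem_classes); vm_compute.
Qed.

Lemma inc_meet_dir tw l t :
  inc (meet_dir tw l t) l && (ldir tw (meet_dir tw l t) l == t).
Proof.
move: t; apply: (forall_listing mem_dirs).
by move: l; apply: (forall_listing mem_classes); case: tw; vm_compute.
Qed.

Lemma ldirK tw c l : inc c l -> meet_dir tw l (ldir tw c l) = c.
Proof.
move=> cl; apply/eqP; move: cl; apply/implyP.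
move: l; apply: (forall_listing mem_classes).
by move: c; apply: (forall_listing mem_classes); case: tw; vm_compute.
Qed.

Lemma sum_pencil c (F : cls -> nat) :
  \sum_(l | inc c l) F l = \sum_s F (join_dir c s).
Proof.
rewrite (reindex_onto (join_dir c) (pdir c)); last by move=> l; apply: pdirK.
by apply: eq_bigl => s; apply: inc_join_dir.
Qed.

Lemma sum_range tw l (F : cls -> nat) :
  \sum_(c | inc c l) F c = \sum_t F (meet_dir tw l t).
Proof.
rewrite (reindex_onto (meet_dir tw l) (ldir tw ^~ l)); last by move=> c; apply: ldirK.
by apply: eq_bigl => s; apply: inc_meet_dir.
Qed.

Lemma card_pencil c (p : pred dir) :
  #|[pred l | inc c l && p (pdir c l)]| = #|p|.
Proof.
rewrite -!sum1_card big_mkcondr sum_pencil [RHS]big_mkcond /=.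
by apply: eq_bigr => s _; have /andP[_ /eqP->] := inc_join_dir c s.
Qed.

Lemma f4addKr k : involutive (f4add^~ k).
Proof.
move=> x; apply/eqP; move: k; apply: (forall_listing mem_l4).
by move: x; apply: (forall_listing mem_l4); vm_compute.
Qed.

(* [f c] is the arc inside the class [c]; [shift] accounts for the carries of
   G_4, which translate the numbering of the segments. *)
Section ArcModel.
Variables (tw : bool) (shift : cls -> dir -> 'I_4) (f : cls -> pred pos).
Let W l t v :=
  sect (f (meet_dir tw l t)) (pdir (meet_dir tw l t) l) (f4add v (shift l t)).
Hypothesis line5 : forall l b, \sum_t W l t (seg t b) <= 5.
Hypothesis sum69 : \sum_c #|f c| = 69.

Let rsumW l t : rsum (W l) t = #|f (meet_dir tw l t)|.
Proof.
rewrite -(sum_sect _ (pdir (meet_dir tw l t) l)) /rsum.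
by rewrite [RHS](reindex_inj (inv_inj (f4addKr (shift l t)))).
Qed.

Let T := lweight inc (fun c => #|f c|).

Let sum_rsumW l : \sum_t rsum (W l) t = T l.
Proof. by rewrite /T /lweight (sum_range tw); apply: eq_bigr. Qed.

Let sect_bound c l v : inc c l -> 4 * sect (f c) (pdir c l) v + T l <= 20 + #|f c|.
Proof.
move=> cl; pose t := ldir tw c l; have E : meet_dir tw l t = c by apply: ldirK.
(* Adding the shift twice cancels it, F_4 having characteristic 2. *)
have := segment_bound (line5 l) t (f4add v (shift l t)).
by rewrite sum_rsumW rsumW /W f4addKr E.
Qed.

(** Adding [sect_bound] over the five line classes through [c] gives at most 100 + 5u; the T(l)
    contribute 69 + 4u, which leaves 31 + u. *)
Let class_bound c g : 4 * \sum_s sect (f c) s (g s) <= 31 + #|f c|.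
Proof.
have := pencil_weight inc_join (fun c => #|f c|) c; rewrite -/T sum69.
have : \sum_(l | inc c l) (4 * sect (f c) (pdir c l) (g (pdir c l)) + T l)
       <= \sum_(l | inc c l) (20 + #|f c|).
  by apply: leq_sum => l; apply: sect_bound.
rewrite (pencil_const inc_join) big_split /= -big_distrr /=.
have -> : \sum_(l | inc c l) sect (f c) (pdir c l) (g (pdir c l)) =
          \sum_s sect (f c) s (g s).
  rewrite sum_pencil; apply: eq_bigr => s _.
  by have /andP[_ /eqP->] := inc_join_dir c s.
move: (\sum_s _) (\sum_(l | inc c l) T l) #|f c|.
by clear; lia.
Qed.

Let f_le4 c : #|f c| <= 4.
Proof. exact: class_le4 (@class_bound c). Qed.

Let d c := 4 - #|f c|.
Let D := lweight inc d.

Let weight_compl l : D l + T l = 20.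
Proof.
rewrite /D /T /lweight -big_split /= (eq_bigr (fun=> 4 * 1)).
  by rewrite -big_distrr /= (range_card inc_meet).
by move=> c _; rewrite /d subnK.
Qed.

Let even c l := even_dir (f c) (pdir c l).

Lemma arc_model_false : False.
Proof.
apply: (@no_deficiency _ _ _ inc_join inc_meet d card_cls _ _ even).
- by move=> c; apply: leq_subr.
(* Twenty-one classes with 4 each make 84, and 84 - 69 = 15. *)
- have : \sum_c d c + \sum_c #|f c| = 84.
    rewrite -big_split /= (eq_bigr (fun=> 4)); last by move=> c _; rewrite /d subnK.
    by rewrite sum_nat_const card_cls.
  by rewrite sum69; clear; lia.
- move=> c dc; have f4 : #|f c| = 4.
    by have := f_le4 c; move: dc; rewrite /d; clear; lia.
  (* By D(l) >= 4w - u, a segment with 4 points gives 16 - 4 = 12, and a nonempty segment of an even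
     class 8 - 4 = 4. *)
  have [[s [v E]]|c3] := class4 (@class_bound c) f4; [left|right].
    have /andP[cl /eqP Es] := inc_join_dir c s; exists (join_dir c s) => //.
    have := sect_bound v cl; rewrite Es E f4; have := weight_compl (join_dir c s).
    by rewrite -/D; clear; lia.
  split; first by rewrite card_pencil.
  move=> l cl /forallP ev; have [v] := sect_avg (f c) (pdir c l).
  have := sect_bound v cl; have := weight_compl l; rewrite f4.
  by rewrite -/D; case/orP: (ev v) => /eqP->; clear; lia.
- move=> c dc; have f3 : #|f c| = 3 by move: dc; rewrite /d; clear; lia.
  (* The same bound gives 12 - 3 = 9 for three collinear points and 8 - 3 = 5 for two. *)
  have [[s [v E]]|c3] := class3 (@class_bound c) f3; [left|right].
    have /andP[cl /eqP Es] := inc_join_dir c s; exists (join_dir c s) => //.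
    have := sect_bound v cl; rewrite Es f3; have := weight_compl (join_dir c s).
    by rewrite -/D; clear -E; lia.
  apply: leq_trans c3 _; rewrite -(card_pencil c); apply: subset_leq_card.
  apply/subsetP=> l; rewrite !inE => /andP[cl /existsP[v E]]; rewrite cl /=.
  have := sect_bound v cl; have := weight_compl l; rewrite f3 -/D.
  by clear -E; lia.
(* D(l) = 4 means 16 arc points on the line class, the situation of [full_row_profile]. *)
- move=> l x Dl xl dx ev y yl.
  have Tl : T l = 16 by have := weight_compl l; rewrite [D l]Dl; clear; lia.
  have H4 t : rsum (W l) t = 4 -> forall v, (W l t v == 0) || (W l t v == 2).
    rewrite rsumW => ft v; have /andP[ml _] := inc_meet_dir tw l t.
    have : even (meet_dir tw l t) l by apply: ev; rewrite // /d ft.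
    by move/forallP; apply.
  have le4 t : rsum (W l) t <= 4 by rewrite rsumW.
  have S16 : \sum_t rsum (W l) t = 16 by rewrite sum_rsumW.
  have rx : rsum (W l) (ldir tw x l) = 4.
    rewrite rsumW ldirK //; have := f_le4 x; move: dx; rewrite /d; clear; lia.
  have := full_row_profile (line5 l) le4 S16 H4 rx (ldir tw y l).
  by rewrite rsumW ldirK // /d; clear; lia.
Qed.
End ArcModel.

(** * Coordinates over a chain ring of length 2 with residue field F_4 *)

Import GRing.Theory.
Local Open Scope ring_scope.

Lemma twistK tw : involutive (twist tw).
Proof.
move=> x; apply/eqP; move: x.
by apply: (forall_listing mem_l4); case: tw; vm_compute.
Qed.

Lemma meet_dir_inj tw l : injective (meet_dir tw l).
Proof.
move=> t t' E; have /andP[_ /eqP<-] := inc_meet_dir tw l t.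
by rewrite E; have /andP[_ /eqP->] := inc_meet_dir tw l t'.
Qed.

Lemma f4addxx x : f4add x x = ord0.
Proof. by apply/eqP; move: x; apply: (forall_listing mem_l4); vm_compute. Qed.

(* [tau] lifts the residue field F_4 to R (additively and multiplicatively up to
   a carry in the radical) and [rho] identifies F_4 with the radical of R. *)
Record chain4 (R : finNzRingType) (tw : bool) (tau rho : 'I_4 -> R) : Prop := Chain4 {
  tau0 : tau ord0 = 0;
  tau1 : tau (mk4 1) = 1;
  decomp : forall r, exists u v, r = tau u + rho v;
  decomp_inj : forall u v u' v',
    tau u + rho v = tau u' + rho v' -> u = u' /\ v = v';
  rhoD : forall u v, rho (f4add u v) = rho u + rho v;
  tau_rho : forall q a, tau q * rho a = rho (f4mul q a);
  rho_tau : forall b x, rho b * tau x = rho (f4mul (twist tw x) b);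
  rho_rho : forall u v, rho u * rho v = 0;
  carry : forall p q x, exists k,
    tau p + tau q * tau x = tau (f4add p (f4mul q x)) + rho k;
  unit_tau : forall u v, u != ord0 -> exists s,
    (tau u + rho v) * s = 1 /\ s * (tau u + rho v) = 1 }.

Section ChainRing.
Variables (R : finNzRingType) (tw : bool) (tau rho : 'I_4 -> R).
Hypothesis ch : chain4 tw tau rho.

Definition vec3 (x y z : R) : vec R := [ffun i : 'I_3 => nth 0 [:: x; y; z] i].

Lemma vec3_scale x y z r :
  vrscale (vec3 x y z) r = vec3 (x * r) (y * r) (z * r).
Proof. by apply/ffunP => -[[|[|[|i]]] lt_i]; rewrite !ffunE. Qed.

Lemma vec3_add x y z x' y' z' :
  vadd (vec3 x y z) (vec3 x' y' z') = vec3 (x + x') (y + y') (z + z').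
Proof. by apply/ffunP => -[[|[|[|i]]] lt_i]; rewrite !ffunE. Qed.

Lemma vec3_zero : vzero R = vec3 0 0 0.
Proof. by apply/ffunP => -[[|[|[|i]]] lt_i]; rewrite !ffunE. Qed.

Lemma vec3_inj x y z x' y' z' :
  vec3 x y z = vec3 x' y' z' -> [/\ x = x', y = y' & z = z'].
Proof.
move/ffunP=> H; move: (H (@Ordinal 3 0 isT)) (H (@Ordinal 3 1 isT)).
by move: (H (@Ordinal 3 2 isT)); rewrite !ffunE.
Qed.

Lemma vec3P (v : vec R) : exists x y z, v = vec3 x y z.
Proof.
exists (v (@Ordinal 3 0 isT)), (v (@Ordinal 3 1 isT)), (v (@Ordinal 3 2 isT)).
apply/ffunP => -[[|[|[|i]]] lt_i]; rewrite !ffunE //=;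
  by congr (v _); apply: val_inj.
Qed.

Lemma rho0 : rho ord0 = 0.
Proof. by apply: (addrI (rho ord0)); rewrite -(rhoD ch) f4addxx addr0. Qed.

Lemma rho_char2 x : rho x + rho x = 0.
Proof. by rewrite -(rhoD ch) f4addxx rho0. Qed.

Lemma rho_mulr v r : exists w, rho v * r = rho w.
Proof.
have [u [w ->]] := decomp ch r; exists (f4mul (twist tw u) v).
by rewrite mulrDr (rho_tau ch) (rho_rho ch) addr0.
Qed.

Lemma rho_neq1 v : rho v <> 1.
Proof.
move=> E; have [] : ord0 = mk4 1 /\ v = ord0; last by [].
by apply: (decomp_inj ch); rewrite (tau0 ch) (tau1 ch) rho0 E add0r addr0.
Qed.

Lemma rho_inj : injective rho.
Proof.
move=> v w E; have [] : ord0 = ord0 :> 'I_4 /\ v = w; last by [].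
by apply: (decomp_inj ch); rewrite E.
Qed.

Lemma rho_or_unit r :
  (exists v, r = rho v) \/ exists s, r * s = 1 /\ s * r = 1.
Proof.
have [u [v ->]] := decomp ch r; have [->|u0] := eqVneq u ord0.
  by left; exists v; rewrite (tau0 ch) add0r.
by right; apply: (unit_tau ch).
Qed.

Definition span1 (v : vec R) : {set vec R} := [set vrscale v r | r : R].

(** Normal form of a point: the first unit coordinate is scaled to 1, [c] holds the residues and [a]
    the radical parts of the other two. *)
Definition pvec (c : cls) (a : pos) : vec R :=
  match c with
  | inl (x, y) => vec3 1 (tau x + rho a.1) (tau y + rho a.2)
  | inr (inl y) => vec3 (rho a.1) 1 (tau y + rho a.2)
  | inr (inr _) => vec3 (rho a.1) (rho a.2) 1
  end.

(** With [lvec2], spans the solutions of a left linear equation for one coordinate. The radical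
    parts [b] are ordered so that [seg t b] is the radical contribution of the line at the class in
    direction [t]. *)
Definition lvec1 (l : cls) (b : pos) : vec R :=
  match l with
  | inl (p, q) => vec3 1 0 (tau p + rho b.2)
  | inr (inl p) => vec3 1 (tau p + rho b.2) 0
  | inr (inr _) => vec3 (rho b.2) 1 0
  end.

Definition lvec2 (l : cls) (b : pos) : vec R :=
  match l with
  | inl (p, q) => vec3 0 1 (tau q + rho b.1)
  | inr (inl p) => vec3 0 (rho b.1) 1
  | inr (inr _) => vec3 (rho b.1) 0 1
  end.

Definition lset l b : {set vec R} :=
  [set vadd (vrscale (lvec1 l b) r) (vrscale (lvec2 l b) s) | r : R, s : R].

Lemma lset_line l b : is_line (lset l b).
Proof.
exists (lvec1 l b), (lvec2 l b); split=> // r s.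
case: l => [[p q]|[p|[]]]; rewrite !vec3_scale vec3_add vec3_zero;
  by case/vec3_inj; rewrite ?mul1r ?mul0r ?addr0 ?add0r.
Qed.

Lemma span1_scale (v : vec R) r s : r * s = 1 -> span1 (vrscale v r) = span1 v.
Proof.
have scaleA (w : vec R) x y : vrscale (vrscale w x) y = vrscale w (x * y).
  by apply/ffunP => i; rewrite !ffunE mulrA.
move=> rs; apply/setP=> w; apply/imsetP/imsetP => -[x _ ->].
  by exists (r * x) => //; rewrite scaleA.
by exists (s * x) => //; rewrite scaleA mulrA rs mul1r.
Qed.

Lemma point_pvec S : is_point S -> exists c a, S = span1 (pvec c a).
Proof.
case=> v [free ->]; have [x [y [z E]]] := vec3P v; rewrite {}E in free *.
have [[x' Ex]|[s [xs sx]]] := rho_or_unit x; last first.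
  have [p [a1 Ea]] := decomp ch (y * s); have [q [a2 Eb]] := decomp ch (z * s).
  exists (inl (p, q)), (a1, a2); rewrite -/(span1 _) -(span1_scale _ sx).
  by rewrite vec3_scale xs Ea Eb.
have [[y' Ey]|[s [ys sy]]] := rho_or_unit y; last first.
  have [a1 Ea] := rho_mulr x' s; have [q [a2 Eb]] := decomp ch (z * s).
  exists (inr (inl q)), (a1, a2); rewrite -/(span1 _) -(span1_scale _ sy).
  by rewrite vec3_scale ys Ex Ea Eb.
have [[z' Ez]|[s [zs sz]]] := rho_or_unit z; last first.
  have [a1 Ea] := rho_mulr x' s; have [a2 Eb] := rho_mulr y' s.
  exists (inr (inr tt)), (a1, a2); rewrite -/(span1 _) -(span1_scale _ sz).
  by rewrite vec3_scale zs Ex Ey Ea Eb.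
(* With all coordinates in the radical, the nonzero element [rho (mk4 1)] would kill the vector,
   against freeness. *)
have : rho (mk4 1) = rho ord0.
  rewrite rho0; apply: free.
  by rewrite vec3_scale vec3_zero Ex Ey Ez !(rho_rho ch).
by move/rho_inj.
Qed.

Lemma pvec_mem c a : pvec c a \in span1 (pvec c a).
Proof.
apply/imsetP; exists 1 => //.
by apply/ffunP=> i; rewrite ffunE mulr1.
Qed.

Lemma span1_pvec_inj c a c' a' :
  span1 (pvec c a) = span1 (pvec c' a') -> c = c' /\ a = a'.
Proof.
move=> E; have := pvec_mem c a; have := pvec_mem c' a'.
rewrite -E {2}E => /imsetP[r' _ E'] /imsetP[r _ {}E]; move: E E'.
case: a a' => [a1 a2] [a1' a2'].
case: c => [[x y]|[y|[]]]; case: c' => [[x' y']|[y'|[]]];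
  rewrite /= !vec3_scale => /vec3_inj[E0 E1 E2] /vec3_inj[F0 F1 F2].
- move: E0 E1 E2; rewrite mul1r => <-; rewrite !mulr1.
  by move=> /(decomp_inj ch)[-> ->] /(decomp_inj ch)[-> ->].
(* For classes of different types, a multiple of a radical element would have to be 1. *)
- by have [w Ew] := rho_mulr a1' r; case: (@rho_neq1 w); rewrite -Ew.
- by have [w Ew] := rho_mulr a1' r; case: (@rho_neq1 w); rewrite -Ew.
- by have [w Ew] := rho_mulr a1 r'; case: (@rho_neq1 w); rewrite -Ew.
- move: E0 E1 E2; rewrite mul1r => E0 E1; rewrite -E1 !mulr1 in E0 *.
  by case/(decomp_inj ch) => -> ->; rewrite (rho_inj E0).
- by have [w Ew] := rho_mulr a2' r; case: (@rho_neq1 w); rewrite -Ew.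
- by have [w Ew] := rho_mulr a1 r'; case: (@rho_neq1 w); rewrite -Ew.
- by have [w Ew] := rho_mulr a2 r'; case: (@rho_neq1 w); rewrite -Ew.
- move: E2; rewrite mul1r => E2; rewrite -E2 !mulr1 in E0 E1.
  by rewrite (rho_inj E0) (rho_inj E1).
Qed.

(** The carry in p + q x when residues are lifted by [tau]. Its existence is the field [carry], so
    the default of [odflt] is never reached. *)
Definition shift (l : cls) (t : dir) : 'I_4 :=
  match l, t with
  | inl (p, q), Some m => odflt ord0 [pick k |
      tau p + tau q * tau (twist tw m) ==
      tau (f4add p (f4mul q (twist tw m))) + rho k]
  | _, _ => ord0
  end.

Lemma shiftE p q m : tau p + tau q * tau (twist tw m) =
  tau (f4add p (f4mul q (twist tw m))) + rho (shift (inl (p, q)) (Some m)).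
Proof.
rewrite /=; case: pickP => [k /eqP //|H].
by have [k Ek] := carry ch p q (twist tw m); have /eqP := H k.
Qed.

(** The hypothesis equates the radical parts in the equation of the line: products of two radical
    elements vanish, and the twist in [meet_dir] cancels the one from [rho_tau]. *)
Lemma incident_mem l t a b :
    seg (pdir (meet_dir tw l t) l) a = f4add (seg t b) (shift l t) ->
  exists r s, pvec (meet_dir tw l t) a =
    vadd (vrscale (lvec1 l b) r) (vrscale (lvec2 l b) s).
Proof.
have f4addx0 x : f4add x ord0 = x.
  by apply/eqP; move: x; apply: (forall_listing mem_l4); vm_compute.
case: a b => [a1 a2] [b1 b2] /(congr1 rho).
have rhoP u v w : rho u + rho v = w -> rho u = w + rho v.
  by move=> <-; rewrite -addrA rho_char2 addr0.
case: l t => [[p q]|[p|[]]] [m|]; rewrite /= ?f4addx0 ?(rhoD ch) => H.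
(* In all six cases the scalars are the point's coordinates at the two positions where the
   generators form an identity matrix. *)
- exists 1, (tau (twist tw m) + rho a1); rewrite !vec3_scale vec3_add.
  rewrite !mul0r !mul1r addr0 add0r mulr1; congr vec3.
  rewrite mulrDl !mulrDr (rho_rho ch) addr0 (rho_tau ch) (tau_rho ch) twistK.
  rewrite [RHS](AC (2*3) (1*3*(2*5*4))) /= shiftE -[RHS]addrA; congr (_ + _).
  by rewrite (rhoP _ _ _ H) addrA; congr (_ + _); rewrite addrC.
- exists (rho a1), 1; rewrite !vec3_scale vec3_add.
  rewrite !mul0r !mul1r addr0 add0r mulr1; congr vec3.
  rewrite mulrDl (tau_rho ch) (rho_rho ch) addr0 (rhoP _ _ _ H).
  by rewrite [RHS]addrC addrA.
- exists 1, (tau (twist tw m) + rho a2); rewrite !vec3_scale vec3_add.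
  rewrite !mul0r !mul1r addr0 add0r mulr1; congr vec3.
  by rewrite mulrDr (rho_rho ch) (rho_tau ch) twistK addr0 H addrA.
- exists (rho a1), 1; rewrite !vec3_scale vec3_add.
  rewrite !mul0r !mul1r addr0 add0r mulr1; congr vec3.
  by rewrite mulrDl (tau_rho ch) (rho_rho ch) addr0 (rhoP _ _ _ H) addrC.
- exists 1, (tau (twist tw m) + rho a2); rewrite !vec3_scale vec3_add.
  rewrite !mul0r !mul1r addr0 add0r mulr1; congr vec3.
  by rewrite mulrDr (rho_rho ch) (rho_tau ch) twistK addr0 H.
- exists (rho a2), 1; rewrite !vec3_scale vec3_add.
  rewrite !mul0r !mul1r addr0 add0r mulr1; congr vec3.
  by rewrite (rho_rho ch) add0r.
Qed.

Lemma span1_sub l t a b :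
    seg (pdir (meet_dir tw l t) l) a = f4add (seg t b) (shift l t) ->
  span1 (pvec (meet_dir tw l t) a) \subset lset l b.
Proof.
move/incident_mem => [r [s ->]]; apply/subsetP=> _ /imsetP[x _ ->].
apply/imset2P; exists (r * x) (s * x) => //.
by apply/ffunP=> i; rewrite !ffunE mulrDl !mulrA.
Qed.

Lemma no_arc69 (A : {set {set vec R}}) : proj_arc 5 A -> #|A| <> 69%N.
Proof.
case=> A_pts A_lines A69.
pose g (z : cls * pos) := span1 (pvec z.1 z.2).
have g_inj : injective g by move=> [c a] [c' a'] /span1_pvec_inj /= [-> ->].
pose f c : pred pos := [pred a | g (c, a) \in A].
apply: (@arc_model_false tw shift f) => [l b|].
  (* [X] collects the arc points that the segment numbering puts on the line; [h] maps them
     injectively into the arc points contained in [lset l b]. *)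
  pose X := [set z : dir * pos | f (meet_dir tw l z.1) z.2 &&
    (seg (pdir (meet_dir tw l z.1) l) z.2 == f4add (seg z.1 b) (shift l z.1))].
  pose h (z : dir * pos) := g (meet_dir tw l z.1, z.2).
  have h_inj : injective h by move=> [t a] [t' a'] /g_inj /= [/meet_dir_inj-> ->].
  apply: leq_trans (A_lines _ (lset_line l b)).
  have <- : #|X| = \sum_t sect (f (meet_dir tw l t)) (pdir (meet_dir tw l t) l)
                             (f4add (seg t b) (shift l t)).
    rewrite -sum1_card.
    rewrite (eq_bigr (fun t => \sum_(a | f (meet_dir tw l t) a &&
      (seg (pdir (meet_dir tw l t) l) a == f4add (seg t b) (shift l t))) 1)%N).
      by rewrite pair_big_dep /=; apply: eq_bigl => z; rewrite inE.
    by move=> t _; rewrite sum1_card.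
  rewrite -(card_imset _ h_inj); apply/subset_leq_card/subsetP=> _ /imsetP[z zX ->].
  by move: zX; rewrite !inE => /andP[fz /eqP /span1_sub sz]; apply/andP.
have AE : A = g @: (g @^-1: A).
  apply/setP=> S; apply/idP/imsetP => [SA|[z]]; last by rewrite inE => ? ->.
  have [c [a ES]] := point_pvec (A_pts _ SA); exists (c, a) => //.
  by rewrite inE /g -ES.
rewrite -A69 [in RHS]AE card_imset // -sum1_card.
rewrite (eq_bigr (fun c => \sum_(a | f c a) 1)%N).
  by rewrite pair_big_dep /=; apply: eq_bigl => -[c a]; rewrite !inE.
by move=> c _; rewrite sum1_card.
Qed.

Lemma proj_arc_sub n (A B : {set {set vec R}}) :
  A \subset B -> proj_arc n B -> proj_arc n A.
Proof.
move=> sAB [B_pts B_lines]; split=> [p /(subsetP sAB)/B_pts //|L /B_lines].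
apply: leq_trans; apply/subset_leq_card/subsetP=> p.
by rewrite !inE => /andP[/(subsetP sAB)-> ->].
Qed.

(** A larger arc would contain one with exactly 69 points, since subsets of arcs are arcs. *)
Lemma chain4_m5_le68 : m_le R 5 68.
Proof.
move=> _ [P [arcP <-]]; rewrite leqNgt; apply/negP=> gt68.
pose A := [set p in take 69 (enum P)].
have sAP : A \subset P.
  by apply/subsetP=> p; rewrite inE => /mem_take; rewrite mem_enum.
apply: (no_arc69 (proj_arc_sub sAP arcP)).
rewrite cardsE (card_uniqP _) ?take_uniq ?enum_uniq // size_takel //.
by rewrite -cardE.
Qed.

End ChainRing.

(** * Verification of the coordinate laws for G_4, S_4 and T_4 *)

Definition chain4b (R : finNzRingType) tw (tau rho : 'I_4 -> R) (elts : seq R) :=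
  [&& tau ord0 == 0, tau (mk4 1) == 1,
   all (fun r => has (fun u => has (fun v => r == tau u + rho v) l4) l4) elts,
   all (fun x => all (fun y =>
     (tau x.1 + rho x.2 == tau y.1 + rho y.2) ==> (x == y)) l16) l16,
   all (fun u => all (fun v =>
     [&& rho (f4add u v) == rho u + rho v,
      tau u * rho v == rho (f4mul u v),
      rho u * tau v == rho (f4mul (twist tw v) u),
      rho u * rho v == 0 &
      (u != ord0) ==> has (fun s => ((tau u + rho v) * s == 1) &&
                                    (s * (tau u + rho v) == 1)) elts]) l4) l4 &
   all (fun p => all (fun q => all (fun x => has (fun k =>
     tau p + tau q * tau x == tau (f4add p (f4mul q x)) + rho k) l4) l4) l4) l4].

Lemma chain4P (R : finNzRingType) tw (tau rho : 'I_4 -> R) elts :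
  (forall r, r \in elts) -> chain4b tw tau rho elts -> chain4 tw tau rho.
Proof.
move=> full /and5P[/eqP t0 /eqP t1 /allP dec /allP inj /andP[/allP laws /allP car]].
have law u v := allP (laws u (mem_l4 u)) v (mem_l4 v).
split=> // [r|u v u' v' E|u v|q a|b x|u v|p q x|u v u0].
- by have /hasP[u _ /hasP[v _ /eqP]] := dec r (full r); exists u, v.
- have /allP/(_ _ (mem_l16 (u', v'))) := inj _ (mem_l16 (u, v)).
  by rewrite /= E eqxx => /eqP[-> ->].
- by have /and5P[/eqP] := law u v.
- by have /and5P[_ /eqP] := law q a.
- by have /and5P[_ _ /eqP] := law b x.
- by have /and5P[_ _ _ /eqP] := law u v.
- have /allP/(_ _ (mem_l4 q))/allP/(_ _ (mem_l4 x)) := car p (mem_l4 p).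
  by case/hasP=> k _ /eqP; exists k.
- have /and5P[_ _ _ _] := law u v; rewrite u0 => /hasP[s _ /andP[/eqP ? /eqP ?]].
  by exists s.
Qed.

(** The two bits of an element of F_4 become coefficients 0 or 1 in Z_4; the radical is 2 G_4, hence
    the factor 2 in [G4_rho]. *)
Definition G4_tau (x : 'I_4) : G4 := (mk4 (x %% 2), mk4 (x %/ 2)).
Definition G4_rho (x : 'I_4) : G4 := (mk4 (2 * (x %% 2)), mk4 (2 * (x %/ 2))).
Definition S4_tau (x : 'I_4) : S4 := (x, ord0).
Definition S4_rho (x : 'I_4) : S4 := (ord0, x).
Definition T4_tau (x : 'I_4) : T4 := (x, ord0).
Definition T4_rho (x : 'I_4) : T4 := (ord0, x).

Lemma G4_chain4 : chain4 false G4_tau G4_rho.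
Proof. by apply: (@chain4P _ _ _ _ (l16 : seq G4)); [apply: mem_l16|vm_compute]. Qed.

Lemma S4_chain4 : chain4 false S4_tau S4_rho.
Proof. by apply: (@chain4P _ _ _ _ (l16 : seq S4)); [apply: mem_l16|vm_compute]. Qed.

Lemma T4_chain4 : chain4 true T4_tau T4_rho.
Proof. by apply: (@chain4P _ _ _ _ (l16 : seq T4)); [apply: mem_l16|vm_compute]. Qed.

Theorem theorem4p14 :
  m_le G4 5 68 /\
  m_le S4 5 68 /\
  m_le T4 5 68.
Proof.
split; first exact: chain4_m5_le68 G4_chain4.
by split; [exact: chain4_m5_le68 S4_chain4|exact: chain4_m5_le68 T4_chain4].
Qed.
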